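(* Let $\dim$ denote either the little finitistic dimension $\operatorname{findim}$ or the big finitistic dimension $\operatorname{FinDim}$ (the same choice throughout). If there exists a finite dimensional algebra $C$ (over a field) with $\dim(C) = \infty$, then there exists a finite dimensional algebra $\Lambda$ (over a field) such that $\dim(\Lambda) = \infty$ and $\dim(\Lambda^{\mathrm{op}}) = 0$.
   Context: All rings are unital and associative, and modules are right modules. A finite dimensional algebra means a finite dimensional algebra over some field (the fields for $C$ and $\Lambda$ need not be the same). $\Lambda^{\mathrm{op}}$ denotes the opposite algebra of $\Lambda$. $\text{Mod-}\Lambda$ (respectively $\text{mod-}\Lambda$) is the category of all (respectively finitely generated) right $\Lambda$-modules, and $\operatorname{pd}_\Lambda(M)$ denotes the projective dimension of $M$. The little and big finitistic dimensions of $\Lambda$ are $$\operatorname{findim}(\Lambda) = \sup\{\operatorname{pd}_\Lambda(M) : M \in \text{mod-}\Lambda,\ \operatorname{pd}_\Lambda(M) < \infty\},$$ $$\operatorname{FinDim}(\Lambda) = \sup\{\operatorname{pd}_\Lambda(M) : M \in \text{Mod-}\Lambda,\ \operatorname{pd}_\Lambda(M) < \infty\}.$$ The (little/big) finitistic dimension conjecture asserts that the (little/big) finitistic dimension of every finite dimensional algebra is finite. *)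

(* Defs.v *)
From HB Require Import structures.
From mathcomp Require Import all_boot all_order all_algebra all_field.
From mathcomp Require Import classical_sets constructive_ereal ereal reals.
From mathcomp Require Import Rstruct.
Set Implicit Arguments.
Unset Strict Implicit.
Unset Printing Implicit Defensive.
Import Order.TTheory GRing.Theory Num.Theory.
Local Open Scope classical_set_scope.
Local Open Scope ring_scope.

(* Right R-modules are left modules over the converse ring R^c: writing x.a
   for (a : R^c) *: x, the law a *: (b *: x) = (a * b : R^c) *: x reads
   (x.b).a = x.(b * a), the last product being taken in R. *)
Definition rmodType (R : nzRingType) := lmodType R^c.

Section Modules.
Variable S : nzRingType.

Definition surjective_map (X Y : Type) (f : X -> Y) : Prop :=
  forall y, exists x, f x = y.

Definition exact_at (X Y Z : lmodType S) (f : X -> Y) (g : Y -> Z) : Prop :=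
  forall y, g y = 0 <-> exists x, f x = y.

Definition projective (P : lmodType S) : Prop :=
  forall (X Y : lmodType S) (g : {linear X -> Y}) (f : {linear P -> Y}),
    surjective_map g -> exists h : {linear P -> X}, forall x, g (h x) = f x.

Definition fin_generated (M : lmodType S) : Prop :=
  exists (n : nat) (g : 'I_n -> M),
    forall x, exists c : 'I_n -> S, x = \sum_i c i *: g i.

(* A projective resolution ... -> P 1 -> P 0 -> M -> 0, with P i = 0 for
   i > n; the differential d i maps P i.+1 to P i. *)
Definition projective_resolution_of_length_le (M : lmodType S) (n : nat) :
    Prop :=
  exists (P : nat -> lmodType S) (d : forall i, {linear P i.+1 -> P i})
         (e : {linear P 0 -> M}),
    [/\ forall i, projective (P i),
        surjective_map e,
        exact_at (d 0) e,
        forall i, exact_at (d i.+1) (d i)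
      & forall i, (n < i)%N -> forall x : P i, x = 0].

(* The value is +oo when there is no finite resolution (ereal_inf set0 = +oo),
   and the zero module has projective dimension 0. *)
Definition pd (M : lmodType S) : \bar Rdefinitions.R :=
  ereal_inf [set n%:R%:E | n in [set n | projective_resolution_of_length_le M n]].

End Modules.

Definition findim (R : nzRingType) : \bar Rdefinitions.R :=
  ereal_sup [set x | exists M : rmodType R,
                       [/\ fin_generated M, (pd M < +oo)%E & x = pd M]].

Definition FinDim (R : nzRingType) : \bar Rdefinitions.R :=
  ereal_sup [set x | exists M : rmodType R, (pd M < +oo)%E /\ x = pd M].

Variant finitistic_kind := Little | Big.

Definition finitistic_dim (k : finitistic_kind) : nzRingType -> \bar Rdefinitions.R :=
  match k with Little => findim | Big => FinDim end.

(* Main.v *)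
(* Let D = Hom(-, K) be the K-linear duality, and let L be the triangular algebra
   with diagonal K[eps]/(eps^2) and C and with corner the K[eps]-C-bimodule DC, on
   which eps acts as zero.

   Right C-modules are the right L-modules killed by the complement of the
   idempotent e of C, and C = eL is projective over L.  Restriction along L -> C
   therefore preserves and reflects projectivity, and by Schanuel's lemma it
   preserves finite projective dimensions, so dim L >= dim C.

   The ideal N = K eps + DC of L has square zero and is isomorphic to D(L/N) as a
   right module.  Let i : P -> Q be an injective map between projective left
   L-modules.  Homomorphisms from Q to (L/N) (x) W, for a K-space W, are the
   K-linear maps NQ -> W; extending such a map from i(NP) to Q by linear algebra,
   and lifting along L (x) W -> (L/N) (x) W, yields rho : Q -> P such that
   n = 1 - rho i maps P into NP.  Hence n^2 = 0 and (1 + n) rho is a retraction of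
   i.  All such i being split, every left L-module of finite projective dimension
   is projective. *)
From HB Require Import structures.
Require Import Defs.
From mathcomp Require Import all_boot all_order all_algebra all_field.
From mathcomp Require Import boolp classical_sets constructive_ereal ereal.
From mathcomp Require Import Rstruct.
Local Open Scope ring_scope.

Set Implicit Arguments.
Unset Strict Implicit.
Unset Printing Implicit Defensive.
Import Order.TTheory GRing.Theory Num.Theory.

(** * Projective dimension through short exact sequences *)

Section ShortExactSequences.
Variable S : nzRingType.
Implicit Types M K P Q X Y : lmodType S.

Definition linear_map X Y (f : X -> Y) (f_lin : linear f) : {linear X -> Y} :=
  HB.pack f (GRing.isLinear.Build S X Y _ f f_lin).

Definition short_exact K P M (i : K -> P) (e : P -> M) : Prop :=
  [/\ injective i, surjective_map e & exact_at i e].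

Lemma factor_through_kernel K P M X (i : {linear K -> P}) (e : P -> M)
    (f : {linear X -> P}) :
  injective i -> exact_at i e -> (forall x, e (f x) = 0) ->
  exists g : {linear X -> K}, forall x, i (g x) = f x.
Proof.
move=> i_inj ie ef.
have /choice[g gP] : forall x, exists y, i y = f x by move=> x; apply/ie.
have g_lin : linear g by move=> a x y; apply: i_inj; rewrite linearP !gP linearP.
by exists (linear_map g_lin).
Qed.

Lemma projective_retract P Q (i : {linear P -> Q}) (r : {linear Q -> P}) :
  cancel i r -> projective Q -> projective P.
Proof.
move=> ir Qproj X Y g f g_surj.
have [h hP] := Qproj X Y g (f \o r : {linear Q -> Y}) g_surj.
by exists (h \o i : {linear P -> X}) => x /=; rewrite hP /= ir.
Qed.

Lemma projective_sum P Q : projective P -> projective Q -> projective (P * Q)%type.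
Proof.
move=> Pp Qp X Y g f g_surj.
have inl_lin : linear (fun p : P => (p, 0 : Q)).
  by move=> a x y; apply: injective_projections; rewrite /= ?scaler0 ?addr0.
have inr_lin : linear (fun q : Q => (0 : P, q)).
  by move=> a x y; apply: injective_projections; rewrite /= ?scaler0 ?addr0.
have [h1 h1P] := Pp X Y g (f \o linear_map inl_lin : {linear P -> Y}) g_surj.
have [h2 h2P] := Qp X Y g (f \o linear_map inr_lin : {linear Q -> Y}) g_surj.
have h_lin : linear (fun x : P * Q => h1 x.1 + h2 x.2).
  by move=> a x y /=; rewrite !linearP scalerDr addrACA.
exists (linear_map h_lin) => -[x y] /=.
rewrite linearD h1P h2P /= -linearD; congr (f _).
by apply: injective_projections; rewrite /= ?addr0 ?add0r.
Qed.

Definition zero_module : lmodType S := 'rV[S]_0.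

Lemma zero_moduleP (x : zero_module) : x = 0.
Proof. exact: thinmx0. Qed.

Lemma projective_zero : projective zero_module.
Proof.
move=> X Y g f _; exists (\0 : {linear zero_module -> X}) => x.
by rewrite (zero_moduleP x) !linear0.
Qed.

(** [pd_le] and [all_syzygies_projective] both express pd M <= n. The form with some syzygies is
    easy to construct, the form with all syzygies passes from a restricted module back to the
    original one, and Schanuel's lemma leads from the first to the second. *)
Fixpoint pd_le (n : nat) M : Prop :=
  if n is m.+1 then
    exists (K P : lmodType S) (i : {linear K -> P}) (e : {linear P -> M}),
      [/\ projective P, short_exact i e & pd_le m K]
  else projective M.

Fixpoint all_syzygies_projective (n : nat) M : Prop :=
  if n is m.+1 then
    forall (K P : lmodType S) (i : {linear K -> P}) (e : {linear P -> M}),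
      projective P -> short_exact i e -> all_syzygies_projective m K
  else projective M.

Lemma pd_le_projective n M : projective M -> pd_le n M.
Proof.
elim: n M => //= n IH M Mp.
exists zero_module, M, \0, idfun; split => //; last exact/IH/projective_zero.
split; first by move=> x y _; rewrite (zero_moduleP x) (zero_moduleP y).
  by move=> y; exists y.
by move=> y /=; split=> [->|[x <-]//]; exists 0.
Qed.

Lemma pd_le_sum n M Q : projective Q -> pd_le n M -> pd_le n (M * Q)%type.
Proof.
case: n => [|n] Qp /=; first by move=> Mp; apply: projective_sum.
move=> [K [P [i [e [Pp [i_inj e_surj ie] Kn]]]]].
have j_lin : linear (fun k : K => (i k, 0 : Q)).
  by move=> a x y; apply: injective_projections; rewrite /= ?linearP ?scaler0 ?addr0.
have f_lin : linear (fun x : P * Q => (e x.1, x.2)).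
  by move=> a x y; apply: injective_projections; rewrite /= ?linearP.
exists K, (P * Q)%type, (linear_map j_lin), (linear_map f_lin).
split => //; first exact: projective_sum.
split; first by move=> x y /= [/i_inj].
  by move=> [x q]; have [p <-] := e_surj x; exists (p, q).
move=> [p q] /=; split=> [[/ie[k <-] ->]|[k [<- <-]]]; first by exists k.
by congr pair; apply/ie; exists k.
Qed.

(* Schanuel: the kernel of a projective cover of a retract of M' is a retract of
   K' + P, where K' is the kernel of any projective cover of M'. *)
Lemma pd_le_retract n M M' (i : {linear M -> M'}) (r : {linear M' -> M}) :
  cancel i r -> pd_le n M' -> all_syzygies_projective n M.
Proof.
elim: n M M' i r => [|n IH] M M' i r ir /=; first exact: projective_retract ir.
move=> [K' [P' [i' [e' [P'p [i'_inj e'_surj ie'] K'n]]]]] K P j e Pp [j_inj e_surj je].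
have [a aP] := Pp _ _ e' (i \o e : {linear P -> M'}) e'_surj.
have [b bP] := P'p _ _ e (r \o e' : {linear P' -> M}) e_surj.
have eba x : e (b (a x)) = e x by rewrite bP /= aP /= ir.
have ei' k : e' (i' k) = 0 by apply/ie'; exists k.
have ej k : e (j k) = 0 by apply/je; exists k.
have [c cP] : exists c : {linear K -> K'}, forall k, i' (c k) = (a \o j) k.
  by apply: factor_through_kernel i'_inj ie' _ => k /=; rewrite aP /= ej linear0.
(* As e b i' = r e' i' = 0 and e b a = e, both summands lie in the kernel of e, so this map factors
   through j as [d]. Since i' c = a j, its value at (c k, j k) is j k, which makes [d] a retraction
   of k |-> (c k, j k). *)
have f_lin : linear (fun x : K' * P => b (i' x.1) + (x.2 - b (a x.2))).
  move=> l x y /=; rewrite !linearP /= !scalerDr.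
  by rewrite [RHS]addrACA; congr (_ + _); rewrite addrACA.
have [d dP] : exists d : {linear (K' * P)%type -> K},
    forall x, j (d x) = linear_map f_lin x.
  apply: factor_through_kernel j_inj je _ => -[x y] /=.
  by rewrite linearD linearB eba subrr bP /= ei' linear0 addr0.
have g_lin : linear (fun k : K => (c k, j k)).
  by move=> l x y; apply: injective_projections; rewrite /= ?linearP.
apply: (IH _ _ (linear_map g_lin) d) (pd_le_sum Pp K'n).
by move=> k; apply: j_inj; rewrite dP /= cP /= addrC subrK.
Qed.

Lemma pd_le_all_syzygies n M : pd_le n M -> all_syzygies_projective n M.
Proof. by apply: (@pd_le_retract _ _ _ idfun idfun). Qed.

(** The bound [pd_le N M] supplies the short exact sequences with projective middle term to which
    the universal condition is applied. *)
Lemma pd_le_of_syzygies N n M :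
  pd_le N M -> all_syzygies_projective n M -> pd_le n M.
Proof.
elim: N n M => [|N IH] [|n] M //=; first by move=> Mp _; exact: (pd_le_projective n.+1).
move=> [K [P [i [e [Pp ie Kn]]]]] Mn; exists K, P, i, e.
by split=> //; apply: IH Kn (Mn _ _ _ _ Pp ie).
Qed.

End ShortExactSequences.

(** * Projective resolutions *)

Section Kernel.
Variables (S : nzRingType) (P M : lmodType S) (e : {linear P -> M}).

Definition kernel_pred : pred P := fun x => e x == 0.

Lemma kernel_submod_closed : submod_closed kernel_pred.
Proof.
split; first by rewrite unfold_in linear0.
by move=> a x y; rewrite !unfold_in linearP => /eqP-> /eqP->; rewrite scaler0 addr0.
Qed.

HB.instance Definition _ := GRing.isSubmodClosed.Build S P kernel_pred
  kernel_submod_closed.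

Record kernel := Kernel { kernel_val : P; _ : kernel_val \in kernel_pred }.
HB.instance Definition _ := [isSub for kernel_val].
HB.instance Definition _ := [Choice of kernel by <:].
HB.instance Definition _ := [SubChoice_isSubLmodule of kernel by <:].

Lemma kernel_val_linear : linear kernel_val.
Proof. by move=> a x y; rewrite -[kernel_val _]/(val _) linearP. Qed.

Lemma exists_kernel :
  exists (K : lmodType S) (i : {linear K -> P}), injective i /\ exact_at i e.
Proof.
exists kernel, (linear_map kernel_val_linear); split; first exact: val_inj.
move=> y; split=> [ey0|[[x xP] /= <-]]; last exact/eqP.
have yP : y \in kernel_pred by apply/eqP.
by exists (Kernel yP).
Qed.

End Kernel.

Section Resolutions.
Variable S : nzRingType.
Implicit Types M P : lmodType S.

Lemma pd_le_of_resolution n M :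
  projective_resolution_of_length_le M n -> pd_le n M.
Proof.
elim: n M => [|n IH] M [P [d [e [Pp e_surj de dd P0]]]] /=.
  (* All terms of positive degree vanish, so [e] is bijective. Its inverse arises by factoring the
     identity through [e], seen as the kernel of the zero map. *)
  have e_inj : injective e.
    by apply: raddf_inj => x /(de x).1[y <-]; rewrite (P0 1%N isT y) linear0.
  have [i iP] : exists i : {linear M -> P 0}, forall x, e (i x) = idfun x.
    by apply: (@factor_through_kernel _ _ _ M _ e (\0 : {linear M -> M})) e_inj _ _ => //.
  exact: projective_retract iP (Pp 0).
(* The resolution is cut at the kernel of [e]: the terms of positive degree, shifted by one, resolve
   K. *)
have [K [i [i_inj ie]]] := exists_kernel e.
have [f fP] : exists f : {linear P 1 -> K}, forall x, i (f x) = d 0 x.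
  by apply: factor_through_kernel i_inj ie _ => x; apply/de; exists x.
exists K, (P 0), i, e; split=> //.
apply: IH; exists (fun j => P j.+1), (fun j => d j.+1), f; split=> //.
- move=> k; have /de[x dx] : e (i k) = 0 by apply/ie; exists k.
  by exists x; apply: i_inj; rewrite fP.
- move=> y; split=> [fy0|/dd dy0]; first by apply/dd; rewrite -fP fy0 linear0.
  by apply: i_inj; rewrite fP dy0 linear0.
- by move=> j jn; apply: P0.
Qed.

Lemma resolution_of_pd_le n M :
  pd_le n M -> projective_resolution_of_length_le M n.
Proof.
elim: n M => [|n IH] M /=.
  move=> Mp; pose P i : lmodType S := if i is 0 then M else zero_module S.
  have Pz i (x : P i.+1) : x = 0 by exact: zero_moduleP.
  exists P, (fun i => \0), idfun; split=> //.
  - by case=> //= i; apply: projective_zero.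
  - by move=> y; exists y.
  - by move=> y; split=> [yz|[x <-] //]; exists 0; exact: esym yz.
  - by move=> i y; split=> // _; exists 0; rewrite (Pz _ y).
  - by case.
move=> [K [P0 [i [e [P0p [i_inj e_surj ie]]]]]] /IH[P [d [f [Pp f_surj df dd P_0]]]].
pose P' j := if j is j'.+1 then P j' else P0.
pose d' j : {linear P' j.+1 -> P' j} :=
  match j with
  | 0 => i \o f
  | j'.+1 => d j'
  end.
exists P', d', e; split=> //.
- by case.
- move=> y; split=> [/ie[k <-]|[x <-]]; last by apply/ie; exists (f x).
  by have [x <-] := f_surj k; exists x.
- case=> [|j] /=; last exact: dd.
  move=> y /=; split=> [iy|/df ->]; last exact: linear0.
  by apply/df; apply: i_inj; rewrite iy linear0.
- by case.
Qed.

Lemma pd_le_resolution n M :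
  projective_resolution_of_length_le M n <-> pd_le n M.
Proof. by split; [exact: pd_le_of_resolution | exact: resolution_of_pd_le]. Qed.

Lemma pd_ltyP M : (pd M < +oo)%E <-> exists n, pd_le n M.
Proof.
rewrite /pd; split=> [|[n /pd_le_resolution Mn]].
  move=> /ereal_inf_lt[_ [n /pd_le_resolution Mn <-] _].
  by exists n.
apply: le_lt_trans (ltry n%:R); apply: ereal_inf_lbound; by exists n.
Qed.

Lemma pd_projective M : projective M -> pd M = 0%E.
Proof.
move=> Mp; apply/eqP; rewrite eq_le; apply/andP; split.
  apply: ereal_inf_lbound; exists 0 => //; exact/pd_le_resolution.
by apply: le_ereal_inf_tmp => _ [n _ <-]; rewrite lee_fin.
Qed.

End Resolutions.

(** * Restriction of scalars *)

(** An alias with the same carrier and addition: linear maps remain the same functions, and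
    exactness needs no new proof after restriction. *)
Definition restrict (A B : nzRingType) (h : {rmorphism A -> B}) (M : lmodType B) :
  Type := M.

Section Restrict.
Variables (A B : nzRingType) (h : {rmorphism A -> B}).
Implicit Types M N P Q X Y : lmodType B.

Section RestrictModule.
Variable M : lmodType B.

HB.instance Definition _ := GRing.Zmodule.copy (restrict h M) M.

Definition restrict_scale (a : A) (x : restrict h M) : restrict h M :=
  h a *: (x : M).

Lemma restrict_scaleA a b x :
  restrict_scale a (restrict_scale b x) = restrict_scale (a * b) x.
Proof. by rewrite /restrict_scale scalerA rmorphM. Qed.

Lemma restrict_scale1 : left_id 1 restrict_scale.
Proof. by move=> x; rewrite /restrict_scale rmorph1 scale1r. Qed.

Lemma restrict_scaleDr : right_distributive restrict_scale +%R.
Proof. by move=> a x y; apply: scalerDr. Qed.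

Lemma restrict_scaleDl x : {morph restrict_scale^~ x : a b / a + b}.
Proof. by move=> a b; rewrite /restrict_scale rmorphD scalerDl. Qed.

HB.instance Definition _ := GRing.Zmodule_isLmodule.Build A (restrict h M)
  restrict_scaleA restrict_scale1 restrict_scaleDr restrict_scaleDl.

End RestrictModule.

Lemma restrictZ M a (x : restrict h M) : a *: x = h a *: (x : M) :> M.
Proof. by []. Qed.

Lemma restrict_linear M N (f : {linear M -> N}) :
  linear (f : restrict h M -> restrict h N).
Proof. by move=> a x y; rewrite restrictZ; exact: linearP. Qed.

Definition restrict_map M N (f : {linear M -> N}) :
  {linear restrict h M -> restrict h N} := linear_map (restrict_linear f).

Section Surjective.
Hypothesis h_surj : surjective_map h.

Lemma unrestrict_linear M N (f : {linear restrict h M -> restrict h N}) :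
  linear (f : M -> N).
Proof. by move=> b x y; have [a <-] := h_surj b; exact: (linearP f). Qed.

(** For surjective h, an A-linear map between restricted modules is B-linear, so a lift found over A
    is a lift over B. *)
Lemma projective_of_restrict P :
  projective (restrict h P : lmodType A) -> projective P.
Proof.
move=> Pp X Y g f g_surj.
have [u uP] := Pp _ _ (restrict_map g) (restrict_map f) g_surj.
by exists (linear_map (unrestrict_linear u)).
Qed.

Lemma fin_generated_restrict M :
  fin_generated M -> fin_generated (restrict h M : lmodType A).
Proof.
move=> [n [g gP]]; exists n, g => x; have [c cP] := gP x.
have /choice[k kP] : forall i, exists a, h a = c i by move=> i; exact: h_surj.
by exists k; rewrite [LHS]cP; apply: eq_bigr => i _; rewrite restrictZ kP.
Qed.

End Surjective.

(* B is identified by j with the left ideal A e of A, where e = j 1. *)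
Section LeftIdeal.
Variable j : B -> A.
Hypothesis j_add : {morph j : x y / x + y}.
Hypothesis hj : cancel j h.
Hypothesis mul_j1 : forall a, a * j 1 = j (h a).

Let jM x y : j (x * y) = j x * j y.
Proof.
by rewrite -{1}[x]hj -{1}[y]hj -rmorphM -mul_j1 -mulrA mul_j1 hj.
Qed.

Lemma section_surjective : surjective_map h.
Proof. by move=> b; exists (j b); rewrite hj. Qed.

Section FixedPart.
Variable X : lmodType A.

Definition fixed_pred : pred X := fun x => j 1 *: x == x.

Lemma fixed_zmod_closed : zmod_closed fixed_pred.
Proof.
split=> [|x y]; first by rewrite unfold_in scaler0.
by rewrite !unfold_in scalerBr => /eqP-> /eqP->.
Qed.

HB.instance Definition _ := GRing.isZmodClosed.Build X fixed_pred
  fixed_zmod_closed.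

Record fixed_part := FixedPart { fixed_val : X; _ : fixed_val \in fixed_pred }.
HB.instance Definition _ := [isSub for fixed_val].
HB.instance Definition _ := [Choice of fixed_part by <:].
HB.instance Definition _ := [SubChoice_isSubZmodule of fixed_part by <:].

Lemma fixed_scale_subproof b (x : fixed_part) : j b *: val x \in fixed_pred.
Proof. by rewrite unfold_in scalerA -jM mul1r. Qed.

Definition fixed_scale b x := FixedPart (fixed_scale_subproof b x).

Lemma fixed_scaleA a b x :
  fixed_scale a (fixed_scale b x) = fixed_scale (a * b) x.
Proof. by apply: val_inj; rewrite /= scalerA jM. Qed.

Lemma fixed_scale1 : left_id 1 fixed_scale.
Proof. by case=> x xP; apply: val_inj; apply/eqP. Qed.

Lemma fixed_scaleDr : right_distributive fixed_scale +%R.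
Proof. by move=> a x y; apply: val_inj; apply: scalerDr. Qed.

Lemma fixed_scaleDl x : {morph fixed_scale^~ x : a b / a + b}.
Proof. by move=> a b; apply: val_inj; rewrite /= j_add scalerDl. Qed.

HB.instance Definition _ := GRing.Zmodule_isLmodule.Build B fixed_part
  fixed_scaleA fixed_scale1 fixed_scaleDr fixed_scaleDl.

Lemma fixed_val_linear :
  linear (fixed_val : restrict h (fixed_part : lmodType B) -> X).
Proof.
move=> a [x xP] y; rewrite -[fixed_val _]/(val _) raddfD /=; congr (_ + _).
by rewrite -mul_j1 -scalerA; congr (_ *: _); exact/eqP.
Qed.

Lemma fixed_val_section b (x y : fixed_part) :
  val (b *: x + y) = j b *: val x + val y.
Proof. exact: raddfD. Qed.

Lemma fixed_in x : j 1 *: x \in fixed_pred.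
Proof. by rewrite unfold_in scalerA -jM mul1r. Qed.

End FixedPart.

(** With e = j 1, the functor X |-> e X, whose value is [fixed_part], is right adjoint to
    restriction along h and preserves surjections. A lifting problem over A is therefore moved to
    the fixed parts, solved over B, and the solution is included back into X. *)
Lemma projective_restrict P :
  projective P -> projective (restrict h P : lmodType A).
Proof.
move=> Pp X Y g f g_surj.
have g_fixed (x : fixed_part X) : g (val x) \in @fixed_pred Y.
  by case: x => x xP; rewrite unfold_in -linearZ /= (eqP xP).
have f_fixed (x : P) : f x \in @fixed_pred Y.
  by rewrite unfold_in -linearZ /= restrictZ hj scale1r.
have gE_lin : linear (fun x => FixedPart (g_fixed x)).
  move=> b x y; apply: val_inj; rewrite [RHS]fixed_val_section.
  by apply: etrans (linearP g _ _ _); congr (g _); exact: fixed_val_section.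
have fE_lin : linear (fun x => FixedPart (f_fixed x)).
  move=> b x y; apply: val_inj; rewrite [RHS]fixed_val_section /= -linearZ restrictZ hj.
  exact: raddfD.
have gE_surj : surjective_map (linear_map gE_lin).
  move=> [y yP]; have [x gx] := g_surj y; exists (FixedPart (fixed_in x)).
  by apply: val_inj; rewrite /= linearZ /= gx; apply/eqP.
have [u uP] := Pp _ _ (linear_map gE_lin) (linear_map fE_lin) gE_surj.
exists (linear_map (@fixed_val_linear X) \o restrict_map u) => x.
by have /(congr1 val) := uP x.
Qed.

Lemma pd_le_restrict n M : pd_le n M -> pd_le n (restrict h M : lmodType A).
Proof.
elim: n M => [|n IH] M /=; first exact: projective_restrict.
move=> [K [P [i [e [Pp ie Kn]]]]].
exists (restrict h K), (restrict h P), (restrict_map i), (restrict_map e).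
by split; [exact: projective_restrict | | exact: IH].
Qed.

Lemma all_syzygies_of_restrict n M :
  all_syzygies_projective n (restrict h M : lmodType A) ->
  all_syzygies_projective n M.
Proof.
elim: n M => [|n IH] M /=; first exact/projective_of_restrict/section_surjective.
move=> Mn K P i e Pp ie; apply: IH.
exact: (Mn _ _ (restrict_map i) (restrict_map e) (projective_restrict Pp) ie).
Qed.

(** The two infima range over the same n. A bound over A holds for all syzygies over A, in
    particular for the restricted ones, and the finite bound N over B then turns it into a bound
    over B. *)
Lemma pd_restrict M : (pd M < +oo)%E -> pd (restrict h M : lmodType A) = pd M.
Proof.
move=> /pd_ltyP[N MN]; congr (ereal_inf (image _ _)).
apply/seteqP; split=> n /= /pd_le_resolution Mn; apply/pd_le_resolution.
  exact/(pd_le_of_syzygies MN)/all_syzygies_of_restrict/pd_le_all_syzygies.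
exact: pd_le_restrict.
Qed.

End LeftIdeal.
End Restrict.

(** * Extension of linear maps *)

(** Zorn's lemma gives a subspace A maximal among those meeting the image of f trivially. It is a
    complement of that image, and r is the projection along A followed by the inverse of f. *)
Lemma linear_retraction (K : fieldType) (V W : lmodType K) (f : {linear V -> W}) :
  injective f -> exists r : {linear W -> V}, cancel f r.
Proof.
move=> f_inj.
pose good (A : set W) := (forall a x y, A x -> A y -> A (a *: x + y)) /\
  (forall v, A (f v) -> v = 0).
have [|A [[A_lin Af] A_max]] := @Zorn_bigcup _ good.
  move=> F F_good F_tot; split=> [a x y [X FX Xx] [Y FY Yy]|v [X FX Xv]].
    have [XY|YX] := F_tot _ _ FX FY.
      by exists Y => //; apply: (F_good _ FY).1 => //; apply: XY.
    by exists X => //; apply: (F_good _ FX).1 => //; apply: YX.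
  exact: (F_good _ FX).2.
have A_maxE B x : good B -> (A `<=` B)%classic -> B x -> A x.
  by move=> Bg AB Bx; apply: contrapT => Ax; apply: (A_max B) => //; split=> // /(_ x Bx).
(* The empty set is [good], being the union of the empty chain, so that A contains 0 has to be drawn
   from maximality. *)
have A0 : A 0.
  apply: (A_maxE [set x | x = 0 \/ A x]%classic); [|by right|by left].
  split=> [a x y /= [->|Ax] [->|Ay]|v [fv0|]]; last exact: Af.
  - by left; rewrite scaler0 addr0.
  - by right; rewrite scaler0 add0r.
  - right; rewrite addr0.
    by rewrite -(subrK x (a *: x)) -{2}[x]scale1r -scalerBl; apply: A_lin.
  - by right; apply: A_lin.
  - by apply: f_inj; rewrite fv0 linear0.
have AZ a x : A x -> A (a *: x) by move=> Ax; rewrite -[_ *: _]addr0; apply: A_lin.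
have AB x y : A x -> A y -> A (x - y).
  by move=> Ax Ay; rewrite addrC -scaleN1r; apply: A_lin.
have /choice[r rP] : forall w, exists v, A (w - f v).
  move=> w; apply: contrapT => w_out.
  suff Aw : A w by apply: w_out; exists 0; rewrite linear0 subr0.
  (* For w outside A + f V, the larger space A + K w still meets f V trivially. *)
  apply: (A_maxE [set x | exists k, A (x - k *: w)]%classic); last 1 first.
  - by exists 1; rewrite scale1r subrr.
  - split=> [a x y [k Ak] [l Al]|v [k Ak]].
      exists (a * k + l); rewrite scalerDl -scalerA opprD addrACA -scalerBr.
      exact: A_lin.
    have [k0|k0] := eqVneq k 0; first by apply: Af; rewrite k0 scale0r subr0 in Ak.
    case: w_out; exists (k^-1 *: v).
    have -> : w - f (k^-1 *: v) = - k^-1 *: (f v - k *: w).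
      by rewrite linearZ scalerBr !scaleNr scalerA mulVf // scale1r opprK addrC.
    exact: AZ.
  - by move=> x Ax; exists 0; rewrite scale0r subr0.
have r_uniq w v : A (w - f v) -> r w = v.
  move=> Av; apply/eqP; rewrite -subr_eq0; apply/eqP/Af.
  have -> : f (r w - v) = (w - f v) - (w - f (r w)).
    by rewrite linearB opprB [RHS]addrC addrA subrK.
  exact: AB.
have r_lin : linear r.
  move=> a x y; apply: r_uniq.
  rewrite linearP opprD addrACA -scalerBr; exact: A_lin.
by exists (linear_map r_lin) => v; apply: r_uniq; rewrite subrr.
Qed.

(** * Splitting of injections between projective modules *)

(** The indices form an arbitrary finite type because one of the bases used later is indexed by a
    disjoint sum. *)
Record is_matrix_rep (S : nzRingType) (K : fieldType) (I : finType)
    (rep : S -> I -> I -> K) : Prop := IsMatrixRep {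
  matrix_repD : forall x y i j, rep (x + y) i j = rep x i j + rep y i j;
  matrix_rep1 : forall i j, rep 1 i j = (i == j)%:R;
  matrix_repM : forall x y i j, rep (x * y) i j = \sum_k rep x i k * rep y k j
}.

(* The column space V^I, on which S acts through a matrix representation. *)
Definition column_module (S : nzRingType) (K : fieldType) (I : finType)
  (rep : S -> I -> I -> K) (repP : is_matrix_rep rep) (V : lmodType K) : Type :=
  {ffun I -> V}.

Section ColumnModule.
Variables (S : nzRingType) (K : fieldType) (I : finType).
Variables (rep : S -> I -> I -> K) (repP : is_matrix_rep rep) (V : lmodType K).

Definition column_scale (x : S) (h : {ffun I -> V}) : {ffun I -> V} :=
  [ffun i => \sum_j rep x i j *: h j].

Lemma column_scaleA x y h :
  column_scale x (column_scale y h) = column_scale (x * y) h.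
Proof.
apply/ffunP => i; rewrite !ffunE.
under eq_bigr do rewrite ffunE scaler_sumr.
rewrite exchange_big; apply: eq_bigr => j _ /=.
rewrite (matrix_repM repP) scaler_suml; apply: eq_bigr => k _.
by rewrite scalerA.
Qed.

Lemma column_scale1 : left_id 1 column_scale.
Proof.
move=> h; apply/ffunP => i; rewrite !ffunE (bigD1 i) //= (matrix_rep1 repP) eqxx.
rewrite scale1r big1 ?addr0 // => j ji.
by rewrite (matrix_rep1 repP) eq_sym (negPf ji) scale0r.
Qed.

Lemma column_scaleDr : right_distributive column_scale +%R.
Proof.
move=> x h k; apply/ffunP => i; rewrite !ffunE -big_split.
by apply: eq_bigr => j _; rewrite ffunE scalerDr.
Qed.

Lemma column_scaleDl h : {morph column_scale^~ h : x y / x + y}.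
Proof.
move=> x y; apply/ffunP => i; rewrite !ffunE -big_split.
by apply: eq_bigr => j _; rewrite (matrix_repD repP) scalerDl.
Qed.

HB.instance Definition _ := GRing.Zmodule.copy (column_module repP V) {ffun I -> V}.
HB.instance Definition _ := GRing.Zmodule_isLmodule.Build S (column_module repP V)
  column_scaleA column_scale1 column_scaleDr column_scaleDl.

Lemma columnZE (x : S) (h : column_module repP V) i :
  (x *: h : {ffun I -> V}) i = \sum_j rep x i j *: (h : {ffun I -> V}) j.
Proof. by rewrite [LHS]ffunE. Qed.

Lemma columnDE (h k : column_module repP V) i :
  (h + k : {ffun I -> V}) i = (h : {ffun I -> V}) i + (k : {ffun I -> V}) i.
Proof. by rewrite [LHS]ffunE. Qed.

End ColumnModule.

Section Splitting.
Variables (S : nzRingType) (K : fieldType) (kappa : {rmorphism K -> S}).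
Hypothesis kappaC : forall k x, kappa k * x = x * kappa k.

Variables (J : finType) (e : J -> S) (c : J -> S -> K).
Hypothesis cP : forall j k x y, c j (kappa k * x + y) = k * c j x + c j y.
Hypothesis ceE : forall i j, c i (e j) = (i == j)%:R.
Hypothesis coordE : forall x, x = \sum_j kappa (c j x) * e j.

(* N is the right ideal with basis f; the pairing (y, x) |-> phi (y * x) on N x S
   has the image of nu as right kernel, modulo which b is the basis dual to f. *)
Variables (I : finType) (f b : I -> S) (phi : S -> K).
Hypothesis phiP : forall k x y, phi (kappa k * x + y) = k * phi x + phi y.
Hypothesis phi_dual : forall i j, phi (f i * b j) = (i == j)%:R.
Hypothesis f_span :
  forall i x, f i * x = \sum_j kappa (phi (f i * x * b j)) * f j.

Let nu (x : S) := x - \sum_i kappa (phi (f i * x)) * b i.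
Hypothesis nu2 : forall x y, nu x * nu y = 0.

Let phiD x y : phi (x + y) = phi x + phi y.
Proof. by have := phiP 1 x y; rewrite rmorph1 !mul1r. Qed.

Let phi0 : phi 0 = 0.
Proof. by apply: (@addrI _ (phi 0)); rewrite -phiD !addr0. Qed.

Let phiZ k x : phi (kappa k * x) = k * phi x.
Proof. by rewrite -[kappa k * x]addr0 phiP phi0 addr0. Qed.

Let phi_sum (A : finType) (F : A -> S) : phi (\sum_i F i) = \sum_i phi (F i).
Proof. exact: (big_morph phi phiD phi0). Qed.

Let cD j x y : c j (x + y) = c j x + c j y.
Proof. by have := cP j 1 x y; rewrite rmorph1 !mul1r. Qed.

Let c0 j : c j 0 = 0.
Proof. by apply: (@addrI _ (c j 0)); rewrite -cD !addr0. Qed.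

Let cZ j k x : c j (kappa k * x) = k * c j x.
Proof. by rewrite -[kappa k * x]addr0 cP c0 addr0. Qed.

Let c_sum j (A : finType) (F : A -> S) : c j (\sum_i F i) = \sum_i c j (F i).
Proof. exact: (big_morph (c j) (cD j) (c0 j)). Qed.

(** Left multiplication by x on S is written in columns in the basis [e], and right multiplication
    on N in rows in the basis [f]; with these conventions both are multiplicative in x without
    reversal. *)
Let left_rep (x : S) (i j : J) := c i (x * e j).
Let right_rep (x : S) (i j : I) := phi (f i * x * b j).

Let left_repP : is_matrix_rep left_rep.
Proof.
split=> [x y i j|i j|x y i j]; first by rewrite /left_rep mulrDl cD.
  by rewrite /left_rep mul1r ceE.
rewrite /left_rep -mulrA [in LHS](coordE (y * e j)) mulr_sumr c_sum.
by apply: eq_bigr => k _; rewrite mulrA -kappaC -mulrA cZ mulrC.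
Qed.

Let right_repP : is_matrix_rep right_rep.
Proof.
split=> [x y i j|i j|x y i j]; first by rewrite /right_rep mulrDr mulrDl phiD.
  by rewrite /right_rep mulr1 phi_dual.
rewrite /right_rep mulrA [in LHS]f_span !mulr_suml phi_sum.
by apply: eq_bigr => k _; rewrite -!mulrA phiZ.
Qed.

Variables (P Q : lmodType S) (iota : {linear P -> Q}).
Hypotheses (Pp : projective P) (Qp : projective Q) (iota_inj : injective iota).

(* X is S (x)_K P, and Y is Hom_K(N, P) for the right ideal N spanned by f. *)
Let V : lmodType K := restrict kappa P.
Let X : lmodType S := column_module left_repP V.
Let Y : lmodType S := column_module right_repP V.
Let coordX (h : X) (j : J) : P := (h : {ffun J -> V}) j.
Let coordY (h : Y) (i : I) : P := (h : {ffun I -> V}) i.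

Let coordXP x h k j :
  coordX (x *: h + k) j = \sum_i kappa (c j (x * e i)) *: coordX h i + coordX k j.
Proof.
by rewrite /coordX columnDE columnZE; congr (_ + _).
Qed.

Let coordYP x h k j :
  coordY (x *: h + k) j =
  \sum_i kappa (phi (f j * x * b i)) *: coordY h i + coordY k j.
Proof. by rewrite /coordY columnDE columnZE; congr (_ + _). Qed.

Let mkX (g : J -> P) : X := [ffun j => (g j : V)].
Let mkY (g : I -> P) : Y := [ffun i => (g i : V)].

Let coord_mkX g j : coordX (mkX g) j = g j.
Proof. exact: ffunE. Qed.

Let coord_mkY g i : coordY (mkY g) i = g i.
Proof. exact: ffunE. Qed.

Let eqY (h k : Y) : (forall i, coordY h i = coordY k i) -> h = k.
Proof. by move=> hk; apply/ffunP => i; exact: hk. Qed.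

(** Pairing u with a tensor in S (x) P gives the same value whether or not the tensor is first
    expanded in the basis [e]. *)
Let phi_coord (A : finType) (u : S) (y : A -> S) (v : A -> P) :
  \sum_j kappa (phi (u * e j)) *: (\sum_a kappa (c j (y a)) *: v a) =
  \sum_a kappa (phi (u * y a)) *: v a.
Proof.
under eq_bigr do rewrite scaler_sumr.
rewrite exchange_big; apply: eq_bigr => a _ /=.
rewrite [in RHS](coordE (y a)) mulr_sumr phi_sum rmorph_sum scaler_suml.
apply: eq_bigr => j _.
by rewrite mulrA -kappaC -mulrA phiZ mulrC rmorphM scalerA.
Qed.

(** On Hom_K(N, P), x acts by (x h)(y) = h(y x); here f i * x is expanded in the basis [f] of N. *)
Let phi_dual_coord (A : finType) i x (y : A -> S) (v : A -> P) :
  \sum_j kappa (phi (f i * x * b j)) *: (\sum_a kappa (phi (f j * y a)) *: v a) =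
  \sum_a kappa (phi (f i * x * y a)) *: v a.
Proof.
under eq_bigr do rewrite scaler_sumr.
rewrite exchange_big; apply: eq_bigr => a _ /=.
rewrite [in RHS]f_span mulr_suml phi_sum rmorph_sum scaler_suml.
by apply: eq_bigr => j _; rewrite -[in RHS]mulrA phiZ rmorphM scalerA.
Qed.

(** This is the multiplication map S (x) P -> P; a preimage of p is 1 (x) p. *)
Let act_lin : linear (fun h : X => \sum_j e j *: coordX h j).
Proof.
move=> x h k; under eq_bigr do rewrite coordXP scalerDr scaler_sumr.
rewrite big_split /= exchange_big scaler_sumr; congr (_ + _).
apply: eq_bigr => i _ /=; rewrite scalerA [in RHS](coordE (x * e i)) scaler_suml.
by apply: eq_bigr => j _; rewrite scalerA kappaC.
Qed.
Let act := linear_map act_lin.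

Let act_surj : surjective_map act.
Proof.
move=> p; exists (mkX (fun j => kappa (c j 1) *: p)) => /=.
under eq_bigr do rewrite coord_mkX scalerA -kappaC.
by rewrite -scaler_suml -coordE scale1r.
Qed.

(** The map sends x (x) p to the K-linear map y |-> phi (y * x) p on N. It plays the role of the
    projection of S (x) P modulo the right kernel of the pairing. *)
Let pi_lin : linear (fun h : X =>
  mkY (fun i => \sum_j kappa (phi (f i * e j)) *: coordX h j)).
Proof.
move=> x h k; apply: eqY => i; rewrite coordYP !coord_mkY.
under [in RHS]eq_bigr do rewrite coord_mkY.
under [in LHS]eq_bigr do rewrite coordXP scalerDr.
rewrite big_split /= phi_coord phi_dual_coord; congr (_ + _).
by apply: eq_bigr => j _; rewrite mulrA.
Qed.
Let pi := linear_map pi_lin.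

Let coord_pi h i : coordY (pi h) i = \sum_j kappa (phi (f i * e j)) *: coordX h j.
Proof. exact: coord_mkY. Qed.

Let pi_surj : surjective_map pi.
Proof.
(* The preimage is the sum of the tensors b i (x) y(f i), written in the basis [e]. *)
move=> y; exists (mkX (fun j => \sum_i kappa (c j (b i)) *: coordY y i)).
apply: eqY => i; rewrite coord_pi; under eq_bigr do rewrite coord_mkX.
rewrite phi_coord (bigD1 i) //= phi_dual eqxx rmorph1 scale1r big1 ?addr0 // => j ji.
by rewrite phi_dual eq_sym (negPf ji) rmorph0 scale0r.
Qed.

Let act_ker h : pi h = 0 -> act h = \sum_j nu (e j) *: coordX h j.
Proof.
move=> pih; under [in RHS]eq_bigr do rewrite scalerBl scaler_suml.
rewrite big_split /= sumrN exchange_big /= [X in _ - X]big1 ?subr0 // => i _.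
transitivity (b i *: coordY (pi h) i); last by rewrite pih [coordY _ _]ffunE scaler0.
rewrite coord_pi scaler_sumr; apply: eq_bigr => j _.
by rewrite scalerA kappaC.
Qed.

Lemma injection_of_projectives_splits : exists r : {linear Q -> P}, cancel iota r.
Proof.
have [s sP] := @Pp X P act idfun act_surj.
(* [T0] is (phi (x) 1) s. By linearity of s, pi (s p) is the map y |-> T0 (y p) on N, so a K-linear
   extension T of [T0] along iota extends pi s to an S-linear map on Q, namely q |-> (y |-> T (y
   q)). *)
pose T0 p := \sum_k kappa (phi (e k)) *: coordX (s p) k.
have T0P x p q : T0 (x *: p + q) =
    \sum_l kappa (phi (x * e l)) *: coordX (s p) l + T0 q.
  rewrite /T0 linearP; under eq_bigr do rewrite coordXP scalerDr.
  rewrite big_split /=; congr (_ + _).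
  under eq_bigr => j do rewrite -[e j]mul1r.
  by rewrite phi_coord; apply: eq_bigr => l _; rewrite mul1r.
have T0_lin : linear (T0 : V -> V).
  move=> a p q; rewrite restrictZ T0P; congr (_ + _).
  rewrite restrictZ scaler_sumr; apply: eq_bigr => l _.
  by rewrite phiZ rmorphM scalerA.
have [ret retK] := linear_retraction (f := restrict_map kappa iota) iota_inj.
pose T (q : Q) : P := T0 (ret q).
have Tiota p : T (iota p) = T0 p by rewrite /T (retK p).
have TP a q q' : T (kappa a *: q + q') = kappa a *: T q + T q'.
  by rewrite -[RHS](T0_lin a) /T; congr T0; exact: (linearP ret a q q').
have T0r : T 0 = 0 by rewrite /T linear0 -[T0 0]/(linear_map T0_lin 0) linear0.
have TD q q' : T (q + q') = T q + T q'.
  by have := TP 1 q q'; rewrite rmorph1 !scale1r.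
have t_lin : linear (fun q : Q => mkY (fun i => T (f i *: q))).
  move=> x q q'; apply: eqY => i; rewrite coordYP !coord_mkY scalerDr TD.
  congr (_ + _); rewrite scalerA [in LHS]f_span scaler_suml (big_morph T TD T0r).
  apply: eq_bigr => j _; rewrite coord_mkY -scalerA.
  by have := TP (phi (f i * x * b j)) (f j *: q) 0; rewrite addr0 T0r addr0.
have [t tP] := @Qp X Y pi (linear_map t_lin) pi_surj.
pose z p := s p - t (iota p).
have pi_z p : pi (z p) = 0.
  apply/eqP; rewrite linearB tP subr_eq0; apply/eqP/eqY => i.
  rewrite coord_pi coord_mkY -linearZ Tiota -[f i *: p]addr0 T0P.
  by rewrite -[T0 0]Tiota linear0 T0r addr0.
have actz p : act (z p) = p - act (t (iota p)) by rewrite linearB sP.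
pose n := idfun \- (act \o t \o iota) : {linear P -> P}.
have nE p : n p = \sum_j nu (e j) *: coordX (z p) j.
  by rewrite -act_ker // actz.
(* By linearity n (n p) is a combination with coefficients nu (e j) * nu (e k), all zero. *)
have nn p : n (n p) = 0.
  rewrite (nE p) linear_sum big1 // => j _.
  rewrite linearZ nE /= scaler_sumr big1 // => k _.
  by rewrite scalerA nu2 scale0r.
(* With rho = act t one has rho iota = 1 - n, and (1 + n)(1 - n) = 1. *)
exists ((act \o t) \+ (n \o (act \o t))) => p.
have /esym/eqP : n (n p) = n p - n (act (t (iota p))) by rewrite -linearB.
rewrite nn subr_eq0 => /eqP np.
by transitivity (act (t (iota p)) + n p); [rewrite np | rewrite addrC subrK].
Qed.

End Splitting.

(** * The triangular algebra *)

Section Extension.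
Variables (K : fieldType) (C : falgType K).

Local Notation dual := 'Hom(C, K^o).

Definition dual_act (g : dual) (x : C) : dual := (g \o amull x)%VF.

Lemma dual_actE g x y : dual_act g x y = g (x * y).
Proof. by rewrite comp_lfunE lfunE. Qed.

(* The quadruple (((k, l), g), x) is the matrix [[k + l eps, g], [0, x]] of the
   triangular algebra with diagonal K[eps]/(eps^2) and C, and corner DC, on which
   eps acts as 0. *)
Definition extension : Type := (K^o * K^o * dual * C)%type.

Implicit Types u v w : extension.

HB.instance Definition _ := Vector.copy extension (K^o * K^o * dual * C)%type.

Definition extension_one : extension := (1, 0, 0, 1).

Definition extension_mul u v : extension :=
  let: (k, l, g, x) := u in
  let: (k', l', g', x') := v in
  (k * k', k * l' + l * k', k *: g' + dual_act g x', x * x').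

Lemma extension_eq u v :
  u.1.1.1 = v.1.1.1 -> u.1.1.2 = v.1.1.2 -> u.1.2 =1 v.1.2 -> u.2 = v.2 -> u = v.
Proof.
by move: u v => [[[k l] g] x] [[[k' l'] g'] x'] /= -> -> /lfunP-> ->.
Qed.

Lemma extension_mulA : associative extension_mul.
Proof.
move=> [[[k l] g] x] [[[k' l'] g'] x'] [[[k'' l''] g''] x''].
apply: extension_eq => /=; rewrite ?mulrA //.
  by rewrite mulrDr mulrDl !mulrA addrA.
move=> y; rewrite !add_lfunE !scale_lfunE !dual_actE add_lfunE scale_lfunE.
by rewrite !dual_actE add_lfunE !scale_lfunE dual_actE scalerDr scalerA mulrA addrA.
Qed.

Lemma extension_mul1 : left_id extension_one extension_mul.
Proof.
move=> [[[k l] g] x]; apply: extension_eq => /=; rewrite ?mul1r ?mul0r ?addr0 //.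
by move=> y; rewrite add_lfunE scale1r dual_actE zero_lfunE addr0.
Qed.

Lemma extension_mulr1 : right_id extension_one extension_mul.
Proof.
move=> [[[k l] g] x]; apply: extension_eq => /=; rewrite ?mulr1 ?mulr0 ?add0r //.
by move=> y; rewrite add_lfunE scaler0 dual_actE zero_lfunE add0r mul1r.
Qed.

Lemma extension_mulDl : left_distributive extension_mul +%R.
Proof.
move=> [[[k l] g] x] [[[k' l'] g'] x'] [[[k'' l''] g''] x''].
apply: extension_eq => /=; rewrite ?mulrDl //; first by rewrite addrACA.
move=> y; rewrite !add_lfunE !scale_lfunE !dual_actE add_lfunE scalerDl.
by rewrite addrACA.
Qed.

Lemma extension_mulDr : right_distributive extension_mul +%R.
Proof.
move=> [[[k l] g] x] [[[k' l'] g'] x'] [[[k'' l''] g''] x''].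
apply: extension_eq => /=; rewrite ?mulrDr //; first by rewrite addrACA.
move=> y; rewrite !add_lfunE !scale_lfunE !dual_actE add_lfunE scalerDr.
by rewrite mulrDl linearD addrACA.
Qed.

Lemma extension_one_neq0 : extension_one != 0.
Proof. by apply/eqP => -[/eqP]; rewrite oner_eq0. Qed.

HB.instance Definition _ := GRing.Zmodule_isNzRing.Build extension
  extension_mulA extension_mul1 extension_mulr1 extension_mulDl extension_mulDr
  extension_one_neq0.

Lemma extension_scalerAl (a : K) u v : a *: (u * v) = (a *: u) * v.
Proof.
move: u v => [[[k l] g] x] [[[k' l'] g'] x'].
apply: extension_eq => /=; rewrite ?scalerAl //; first by rewrite scalerDr !scalerAl.
by move=> y; rewrite !(add_lfunE, scale_lfunE, dual_actE) scalerDr scalerA.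
Qed.

HB.instance Definition _ := GRing.Lmodule_isLalgebra.Build K extension
  extension_scalerAl.

Lemma extension_scalerAr (a : K) u v : a *: (u * v) = u * (a *: v).
Proof.
move: u v => [[[k l] g] x] [[[k' l'] g'] x'].
apply: extension_eq => /=; rewrite ?scalerAr //; first by rewrite scalerDr !scalerAr.
move=> y; rewrite !(add_lfunE, scale_lfunE, dual_actE) scalerDr -scalerAl.
by rewrite [g (_ *: _)]linearZ /= !scalerA [a * _]mulrC.
Qed.

HB.instance Definition _ := GRing.Lalgebra_isAlgebra.Build K extension
  extension_scalerAr.
HB.instance Definition _ := Algebra_isFalgebra.Build K extension.


End Extension.

(** * Its finitistic dimensions *)

Definition ring_map (A B : nzRingType) (h : A -> B) (hB : zmod_morphism h)
    (hM : monoid_morphism h) : {rmorphism A -> B} :=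
  HB.pack h (GRing.isZmodMorphism.Build A B h hB)
            (GRing.isMonoidMorphism.Build A B h hM).

Section ExtensionHomology.
Variables (K : fieldType) (C : falgType K).
Local Notation L := (extension C).

Definition extension_proj (u : L^c) : C^c := u.2.

Lemma extension_proj_additive : zmod_morphism extension_proj.
Proof. by []. Qed.

Lemma extension_proj_monoid : monoid_morphism extension_proj.
Proof. by split=> // -[[[k l] g] x] [[[k' l'] g'] x']. Qed.

Definition extension_projection : {rmorphism L^c -> C^c} :=
  ring_map extension_proj_additive extension_proj_monoid.

Definition extension_section (x : C^c) : L^c := ((0, 0, 0, x) : L).

Lemma extension_sectionD : {morph extension_section : x y / x + y}.
Proof. by move=> x y; congr (_, _, _, _); rewrite ?addr0. Qed.

Lemma extension_projK : cancel extension_section extension_projection.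
Proof. by []. Qed.

(** The product is that of the converse ring: in L it is e u, the bottom row of the matrix u, whose
    only nonzero entry is the one in C. Hence e L is C. *)
Lemma extension_mul_section (u : L^c) :
  u * extension_section 1 = extension_section (extension_projection u).
Proof.
case: u => [[[k l] g] x]; apply: extension_eq => //=.
- exact: mul0r.
- by rewrite !mul0r addr0.
- by move=> y; rewrite add_lfunE scale_lfunE scale0r dual_actE !zero_lfunE add0r.
- exact: mul1r.
Qed.

Lemma pd_extension (M : rmodType C) : (pd M < +oo)%E ->
  pd (restrict extension_projection M : rmodType L) = pd M.
Proof.
move=> Mfin.
exact: (pd_restrict extension_sectionD extension_projK extension_mul_section).
Qed.

Lemma fin_generated_extension (M : rmodType C) : fin_generated M ->
  fin_generated (restrict extension_projection M : rmodType L).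
Proof. exact: fin_generated_restrict (section_surjective extension_projK) _. Qed.

Lemma finitistic_dim_extension k :
  (finitistic_dim k C <= finitistic_dim k L)%E.
Proof.
case: k; apply: ereal_sup_le => d [M].
  move=> [Mfg Mfin ->]; exists (restrict extension_projection M).
  by split; [exact: fin_generated_extension | rewrite pd_extension..].
move=> [Mfin ->]; exists (restrict extension_projection M).
by split; rewrite pd_extension.
Qed.

End ExtensionHomology.

(** * Duality on the ideal N and left modules over the triangular algebra *)

Section Splitting.
Variables (K : fieldType) (C : falgType K).
Local Notation L := (extension C).
Local Notation dual := 'Hom(C, K^o).
Local Notation d := (\dim {:C}).
Local Notation X := (vbasis {:C}).

Lemma x_coord_linear i : linear (coord X i : C -> K^o).
Proof. by move=> a x y; rewrite linearP. Qed.

Definition x_coord i : dual := linfun (linear_map (x_coord_linear i)).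

Lemma x_coordE i x : x_coord i x = coord X i x.
Proof. by rewrite lfunE. Qed.

Lemma x_coord_sum (g : dual) : g = \sum_(i < d) g X`_i *: x_coord i.
Proof.
apply/lfunP => x; rewrite sum_lfunE {1}(coord_vbasis (memvf x)) linear_sum.
by apply: eq_bigr => i _; rewrite linearZ scale_lfunE x_coordE; exact: mulrC.
Qed.

Lemma x_coord_dual (i j : 'I_d) : coord X i X`_j = (i == j)%:R.
Proof. by rewrite coord_free ?(basis_free (vbasisP _)) 1?eq_sym. Qed.

(** For y = l eps + g in N and u with diagonal entries k + l' eps and x, the value at y * u is l k +
    g x. This is the perfect pairing that identifies N with D(L/N). *)
Definition eps_functional (u : L) : K := u.1.1.2 + u.1.2 1.

Definition socle_basis (i : 'I_d + unit) : L :=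
  if i is inl i then (0, 0, x_coord i, 0) else (0, 1, 0, 0).

Definition dual_basis (i : 'I_d + unit) : L :=
  if i is inl i then (0, 0, 0, X`_i) else (1, 0, 0, 0).

Lemma eps_functionalP a (u v : L) :
  eps_functional (a%:A * u + v) = a * eps_functional u + eps_functional v.
Proof.
rewrite -scalerAl mul1r; case: u v => [[[k l] g] x] [[[k' l'] g'] x'].
by rewrite /eps_functional /= add_lfunE scale_lfunE mulrDr addrACA.
Qed.

Lemma socle_basisM i (u : L) : socle_basis i * u =
  if i is inl i then (0, 0, dual_act (x_coord i) u.2, 0) else (0, u.1.1.1, 0, 0).
Proof.
case: u => [[[k l] g] x]; case: i => [i|i]; apply: extension_eq => /=;
  rewrite ?mul0r ?mul1r ?addr0 ?add0r //.
  by move=> y; rewrite add_lfunE scale_lfunE scale0r add0r.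
by move=> y; rewrite add_lfunE scale_lfunE scale0r add0r dual_actE !zero_lfunE.
Qed.

Lemma eps_functional_socle i (u : L) :
  eps_functional (socle_basis i * u) =
  if i is inl i then coord X i u.2 else u.1.1.1.
Proof.
rewrite socle_basisM; case: i => [i|i]; rewrite /eps_functional /=.
  by rewrite dual_actE x_coordE mulr1 add0r.
by rewrite zero_lfunE addr0.
Qed.

Lemma eps_functional_dual i j :
  eps_functional (socle_basis i * dual_basis j) = (i == j)%:R.
Proof.
rewrite eps_functional_socle; case: i j => [i|[]] [j|[]] //=.
  exact: x_coord_dual.
by rewrite linear0.
Qed.

Lemma extension_sum (I : finType) (F : I -> L) : \sum_i F i =
  (\sum_i (F i).1.1.1, \sum_i (F i).1.1.2, \sum_i (F i).1.2, \sum_i (F i).2).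
Proof.
apply: extension_eq => [||y|] /=.
- exact: (big_morph (fun u : L => u.1.1.1)).
- exact: (big_morph (fun u : L => u.1.1.2)).
- by congr (fun_of_lfun _ _); exact: (big_morph (fun u : L => u.1.2)).
- exact: (big_morph (fun u : L => u.2)).
Qed.

Lemma socle_basis_mul i (u : L) : socle_basis i * u =
  \sum_j (eps_functional (socle_basis i * u * dual_basis j))%:A * socle_basis j.
Proof.
under eq_bigr do rewrite -scalerAl mul1r -mulrA eps_functional_socle.
rewrite big_sumType (big_pred1 tt) /=; last by case.
rewrite socle_basisM extension_sum.
case: u i => [[[k l] g] x] [i|[]] /=; apply: extension_eq => [||y|] /=.
- by rewrite -scaler_suml !scaler0 addr0.
- by rewrite -scaler_suml scaler0 mulr0 linear0 scale0r addr0.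
- rewrite scaler0 addr0; congr (fun_of_lfun _ _); rewrite {1}[dual_act _ _]x_coord_sum.
  by apply: eq_bigr => j _; rewrite dual_actE x_coordE.
- by rewrite -scaler_suml !scaler0 addr0.
- by rewrite -scaler_suml !scaler0 addr0.
- by rewrite -scaler_suml scaler0 add0r mulr1; exact/esym/mulr1.
- rewrite scaler0 addr0 big1 // => i _; by rewrite mulr0 scale0r.
- by rewrite -scaler_suml !scaler0 addr0.
Qed.

(** The left side is [nu] of the splitting criterion. Its image is thus N, whose square vanishes by
    [off_diagonal_mul]. *)
Lemma dual_basis_coord (u : L) :
  u - \sum_i (eps_functional (socle_basis i * u))%:A * dual_basis i =
  (0, u.1.1.2, u.1.2, 0).
Proof.
under eq_bigr do rewrite -scalerAl mul1r eps_functional_socle.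
rewrite big_sumType (big_pred1 tt) /=; last by case.
rewrite extension_sum.
case: u => [[[k l] g] x]; apply: extension_eq => [||y|] /=.
- rewrite -scaler_suml scaler0 add0r -[X in _ - X]/(k * 1) mulr1; exact: subrr.
- by rewrite -scaler_suml !scaler0 addr0 subr0.
- by rewrite -scaler_suml !scaler0 addr0 subr0.
- by rewrite scaler0 addr0 -(coord_vbasis (memvf x)) subrr.
Qed.

Lemma off_diagonal_mul (l l' : K) (g g' : dual) :
  ((0, l, g, 0) : L) * (0, l', g', 0) = 0.
Proof.
apply: extension_eq => [||y|] /=.
- exact: mul0r.
- by rewrite mul0r mulr0 addr0.
- by rewrite add_lfunE scale_lfunE scale0r dual_actE mul0r linear0 zero_lfunE addr0.
- exact: mul0r.
Qed.

(** Right modules over L^c are modules over the double converse, whose product is that of L: they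
    are the left L-modules. *)
Lemma converse_scalar_zmod : zmod_morphism (fun a : K => a%:A : (L^c)^c).
Proof. by move=> a b; exact: scalerBl. Qed.

Lemma converse_scalar_monoid : monoid_morphism (fun a : K => a%:A : (L^c)^c).
Proof.
split=> [|a b]; first exact: scale1r.
by rewrite -[RHS]/((a%:A : L) * (b%:A : L)) -scalerAl mul1r scalerA.
Qed.

Lemma extension_injection_splits (P Q : rmodType L^c) (i : {linear P -> Q}) :
  projective P -> projective Q -> injective i ->
  exists r : {linear Q -> P}, cancel i r.
Proof.
pose kappa := ring_map converse_scalar_zmod converse_scalar_monoid.
pose e (j : 'I_(\dim {:L})) : (L^c)^c := (vbasis {:L})`_j.
pose c (j : 'I_(\dim {:L})) (u : (L^c)^c) : K := coord (vbasis {:L}) j (u : L).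
have kappaC a (u : L) : (a%:A : L) * u = u * a%:A.
  by rewrite -scalerAl -scalerAr mul1r mulr1.
apply: (@injection_of_projectives_splits (L^c)^c K kappa kappaC _ e c _ _ _
  _ socle_basis dual_basis eps_functional).
- move=> j a u v; rewrite /c -[kappa a * u]/((a%:A : L) * (u : L)) -scalerAl mul1r.
  exact: linearP.
- by move=> j k; rewrite /c /e coord_free ?(basis_free (vbasisP _)) 1?eq_sym.
- move=> u; rewrite [LHS](coord_vbasis (memvf (u : L))).
  apply: eq_bigr => j _.
  by rewrite -[RHS]/(((c j u)%:A : L) * (e j : L)) -scalerAl mul1r.
- exact: eps_functionalP.
- exact: eps_functional_dual.
- exact: socle_basis_mul.
- move=> u v.
  apply: etrans (off_diagonal_mul u.1.1.2 v.1.1.2 u.1.2 v.1.2).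
  exact: congr2 (dual_basis_coord u) (dual_basis_coord v).
Qed.

End Splitting.

(** * Vanishing of the finitistic dimensions *)

(** By induction the first syzygy is projective, so its inclusion splits and M is a direct summand
    of P. *)
Lemma projective_of_pd_le (S : nzRingType) :
  (forall (P Q : lmodType S) (i : {linear P -> Q}),
     projective P -> projective Q -> injective i ->
     exists r : {linear Q -> P}, cancel i r) ->
  forall n (M : lmodType S), pd_le n M -> projective M.
Proof.
move=> splits; elim=> [//|n IH] M [N [P [i [e [Pp [i_inj e_surj ie] /IH Np]]]]].
have [r rP] := splits _ _ i Np Pp i_inj.
have /choice[s sP] := e_surj.
(* Since x - i (r x) depends only on e x, any choice of preimages [s] yields a linear section of
   e. *)
have diff x y : e x = e y -> x - i (r x) = y - i (r y).
  move=> exy; have /ie[k kP] : e (x - y) = 0 by rewrite linearB exy subrr.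
  have -> : x = i k + y by rewrite kP subrK.
  by rewrite !linearD rP /= addrACA subrr add0r.
have t_lin : linear (fun m => s m - i (r (s m))).
  move=> a m m'; rewrite (diff (s (a *: m + m')) (a *: s m + s m')).
    by rewrite !linearP /= addrACA -scalerDr.
  by rewrite linearP !sP.
apply: (projective_retract (i := linear_map t_lin) (r := e)) => // m /=.
by rewrite linearB sP (_ : e (i _) = 0) ?subr0 //; apply/ie; exists (r (s m)).
Qed.

Lemma finitistic_dim_eq0 (A : nzRingType) k :
  (forall (P Q : rmodType A) (i : {linear P -> Q}),
     projective P -> projective Q -> injective i ->
     exists r : {linear Q -> P}, cancel i r) ->
  finitistic_dim k A = 0%E.
Proof.
move=> splits; have pd0 (M : rmodType A) : (pd M < +oo)%E -> pd M = 0%E.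
  by move=> /pd_ltyP[n /(projective_of_pd_le splits)/pd_projective].
(* The zero module makes the supremum at least 0; over an empty set it would be -oo. *)
have pdz : pd (zero_module A^c) = 0%E by apply/pd_projective/projective_zero.
have zfg : fin_generated (zero_module A^c).
  by exists 0, (fun=> 0) => x; exists (fun=> 0); rewrite big_ord0; exact: zero_moduleP.
apply/eqP; rewrite eq_le; apply/andP; split; case: k.
- by apply: ge_ereal_sup => d [M [_ Mfin ->]]; rewrite pd0.
- by apply: ge_ereal_sup => d [M [Mfin ->]]; rewrite pd0.
- by apply: ereal_sup_ubound; exists (zero_module A^c); split; rewrite ?pdz.
- by apply: ereal_sup_ubound; exists (zero_module A^c); split; rewrite ?pdz.
Qed.

Theorem theorem2 (dim_kind : finitistic_kind) :
  (exists (K : fieldType) (C : falgType K),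
     finitistic_dim dim_kind C = +oo%E) ->
  exists (F : fieldType) (L : falgType F),
    finitistic_dim dim_kind L = +oo%E /\ finitistic_dim dim_kind L^c = 0%E.
Proof.
move=> [K [C Cy]]; exists K, (extension C); split.
  by apply/eqP; rewrite -leye_eq -Cy; exact: finitistic_dim_extension.
apply: finitistic_dim_eq0; exact: extension_injection_splits.
Qed.
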